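(* Let $\mathcal{R} = \langle R, \lesssim\rangle$ be a rulebook on $\mathcal{T}\times\mathcal{E}$ in which every rule $r\in R$ is measurable and is equipped with a risk measure $\rho_r : \mathcal{F}(\Omega,\mathbb{R})\to\mathbb{R}$ and a threshold $\gamma_r\in\mathbb{R}$, and let $\tau^*\in\mathcal{T}$ be an optimal trajectory with respect to the induced risk-aware rulebook $\mathcal{R}_{\text{risk}}$ on $\mathcal{T}$. Suppose that for every $r\in R$ the risk measure $\rho_r$ is monotone (for all $f,f'\in\mathcal{F}(\Omega,\mathbb{R})$, if $f\le f'$ almost surely then $\rho_r(f)\le\rho_r(f')$) and strictly monotone (for all $f,f'\in\mathcal{F}(\Omega,\mathbb{R})$, if $f\le f'$ almost surely and $\mathit{Pr}(f<f')>0$, then $\rho_r(f)<\rho_r(f')$). Suppose there exist a trajectory $\tau'\in\mathcal{T}$, a rule $r'\in R$ and an outcome $\omega\in\Omega$ with $r'_{\tau'}(\omega)<r'_{\tau^*}(\omega)$. Then at least one of the following holds: (i) $\mathit{Pr}(r'_{\tau'}<r'_{\tau^*})=0$; (ii) $\rho_{r'}(r'_{\tau^*})\le\gamma_{r'}$, i.e. $r'_{\text{risk}}(\tau^* )=0$; (iii) there exists a rule $r^*\in R$ with $r^*\not< r'$ such that $\mathit{Pr}(r^*_{\tau'}>r^*_{\tau^*})>0$.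
   Context: A preorder $\lesssim$ is a reflexive and transitive binary relation; its strict part is: $a<b$ iff $a\lesssim b$ and not $b\lesssim a$ (also written $b>a$). A rule on a set $\Xi$ is a function $\Xi\to\mathbb{R}_{\ge 0}$. A rulebook on $\Xi$ is a tuple $\langle R,\lesssim\rangle$ where $R$ is a finite set of rules on $\Xi$ and $\lesssim$ is a preorder on $R$; $r'>r$ means $r'$ has higher priority than $r$. Setting: $\mathcal{T}$ (system trajectories) and $\mathcal{E}$ (environment trajectories) are standard Borel spaces; $(\Omega,\Sigma,\mathit{Pr})$ is a probability space with $\Omega$ nonempty and $\Sigma$ standard Borel; $\mathbf{E}:\mathcal{T}\times\Omega\to\mathcal{E}$ is a Borel function, and $\mathbf{E}_\tau(\omega)=\mathbf{E}(\tau,\omega)$. $\mathcal{F}(\Omega,\mathbb{R})$ is the set of measurable functions $\Omega\to\mathbb{R}$. A risk measure is a map $\mathcal{F}(\Omega,\mathbb{R})\to\mathbb{R}$. ''Almost surely'' means outside a set of $\mathit{Pr}$-probability zero. For $f,f'\in\mathcal{F}(\Omega,\mathbb{R})$, $\mathit{Pr}(f<f')$ denotes $\mathit{Pr}(\{\omega\in\Omega\mid f(\omega)<f'(\omega)\})$, and similarly for $>$. For a measurable rule $r:\mathcal{T}\times\mathcal{E}\to\mathbb{R}_{\ge 0}$ with risk measure $\rho_r$ and threshold $\gamma_r$, and $\tau\in\mathcal{T}$, let $r_\tau:\Omega\to\mathbb{R}_{\ge 0}$, $r_\tau(\omega)=r(\tau,\mathbf{E}_\tau(\omega))$ (a measurable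 function). The risk-aware rule induced by $(r,\rho_r,\gamma_r)$ is $r_{\text{risk}}:\mathcal{T}\to\mathbb{R}_{\ge 0}$, $r_{\text{risk}}(\tau)=\max\{\rho_r(r_\tau)-\gamma_r,0\}$. The induced risk-aware rulebook is $\mathcal{R}_{\text{risk}}=\langle R_{\text{risk}},\lesssim_{\text{risk}}\rangle$ with $R_{\text{risk}}=\{r_{\text{risk}} \mid r\in R\}$ and $r_{\text{risk}}\lesssim_{\text{risk}} r'_{\text{risk}}$ if and only if $r\lesssim r'$. Here the elements of $R_{\text{risk}}$ are regarded as indexed by $R$ (distinct rules give distinct elements even if the functions coincide). For $\tau,\tau'\in\mathcal{T}$: $\tau\lesssim_{\mathcal{R}_{\text{risk}}}\tau'$ iff for every $r_{\text{risk}}\in R_{\text{risk}}$ with $r_{\text{risk}}(\tau)>r_{\text{risk}}(\tau')$ there exists $r'_{\text{risk}}>_{\text{risk}} r_{\text{risk}}$ with $r'_{\text{risk}}(\tau')>r'_{\text{risk}}(\tau)$. And $\tau<_{\mathcal{R}_{\text{risk}}}\tau'$ iff $\tau\lesssim_{\mathcal{R}_{\text{risk}}}\tau'$ but not $\tau'\lesssim_{\mathcal{R}_{\text{risk}}}\tau$. A trajectory $\tau^*\in\mathcal{T}$ is optimal if there is no $\tau\in\mathcal{T}$ with $\tau<_{\mathcal{R}_{\text{risk}}}\tau^*$. *)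

(* Defs.v *)
From HB Require Import structures.
From mathcomp Require Import all_boot all_order all_algebra.
From mathcomp Require Import all_classical all_reals all_analysis.

Set Implicit Arguments.
Unset Strict Implicit.
Unset Printing Implicit Defensive.

Import Order.TTheory GRing.Theory Num.Theory.

Local Open Scope classical_set_scope.
Local Open Scope ring_scope.

Section standard_borel.
Context {R : realType}.

Definition polish (X : metricType R) : Prop :=
  (forall F : set_system X, ProperFilter F -> cauchy F ->
     exists x : X, F --> x) /\
  (exists2 D : set X, countable D & dense D).

(* The sigma-algebra of [T] is the Borel sigma-algebra of some Polish space,
   transported along a bijection. *)
Definition standard_borel d (T : measurableType d) : Prop :=
  exists (X : metricType R) (f : T -> X),
    [/\ polish X, bijective f &
        forall A : set T,
          measurable A <-> exists2 B : set X, <<s open >> B & A = f @^-1` B].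

End standard_borel.
Arguments standard_borel R {d} T.

Definition rule (R : realType) (Xi : Type) := Xi -> {nonneg R}.

(* The priority order is a relation on the rules of the rulebook only:
   [rules] coerces to the subtype of its elements. *)
Record rulebook (R : realType) (Xi : Type) := Rulebook {
  rules : set (rule R Xi) ;
  rules_finite : finite_set rules ;
  prio : rel rules ;
  prio_refl : reflexive prio ;
  prio_trans : transitive prio }.
Arguments prio {R Xi}.

Lemma finite_setT_rules (R : realType) (Xi : Type) (B : rulebook R Xi) :
  finite_set [set: rules B].
Proof.
by rewrite (eq_finite_set (card_setT (rules B))); exact: rules_finite.
Qed.

(* A rulebook whose rules are labelled by [I]: distinct labels are distinct
   rules, even when the associated functions coincide. *)
Record indexed_rulebook (R : realType) (I Xi : Type) := IndexedRulebook {
  irule : I -> rule R Xi ;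
  irule_finite : finite_set [set: I] ;
  iprio : rel I ;
  iprio_refl : reflexive iprio ;
  iprio_trans : transitive iprio }.

Definition strict (I : Type) (le : rel I) : rel I :=
  fun i j => le i j && ~~ le j i.

Section trajectory_order.
Context {R : realType} {I Xi : Type} (B : indexed_rulebook R I Xi).

Definition traj_le (x y : Xi) : Prop :=
  forall i : I, (irule B i x)%:num > (irule B i y)%:num ->
    exists2 j : I, strict (iprio B) i j &
                   (irule B j y)%:num > (irule B j x)%:num.

Definition traj_lt (x y : Xi) : Prop := traj_le x y /\ ~ traj_le y x.

Definition optimal (x : Xi) : Prop := ~ exists y : Xi, traj_lt y x.

End trajectory_order.

Definition risk_measure (R : realType) d (Omega : measurableType d) :=
  {mfun Omega >-> R} -> R.

Section risk_measures.
Context {R : realType} {d} {Omega : measurableType d} (P : probability Omega R).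

Definition monotone_risk (rho : risk_measure R Omega) : Prop :=
  forall f g : {mfun Omega >-> R},
    {ae P, forall w, f w <= g w} -> rho f <= rho g.

Definition strictly_monotone_risk (rho : risk_measure R Omega) : Prop :=
  forall f g : {mfun Omega >-> R},
    {ae P, forall w, f w <= g w} ->
    (0 < P [set w | (f w < g w)%R])%E -> rho f < rho g.

End risk_measures.

Section risk_aware.
Context {R : realType} {dT dE dO : measure_display}.
Context {T : measurableType dT} {E : measurableType dE}
        {Omega : measurableType dO}.
Variable env : {mfun (T * Omega)%type >-> E}.

Definition measurable_rule (r : rule R (T * E)) : Prop :=
  measurable_fun [set: T * E] (fun x => (r x)%:num).

Definition outcome (r : rule R (T * E)) (tau : T) : Omega -> R :=
  fun w => (r (tau, env (tau, w)))%:num.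

Lemma measurable_outcome (r : rule R (T * E)) (mr : measurable_rule r)
  (tau : T) : measurable_fun [set: Omega] (outcome r tau).
Proof.
apply: (measurableT_comp mr).
apply/measurable_fun_pair => //=.
apply: (measurableT_comp (measurable_funPT env)).
exact: measurable_fun_pair.
Qed.

Definition outcome_mfun (r : rule R (T * E)) (mr : measurable_rule r)
    (tau : T) : {mfun Omega >-> R} :=
  mfun_Sub (mem_set (measurable_outcome mr tau) : outcome r tau \in mfun).

Lemma max0r_ge0 (x : R) : 0 <= Num.max x 0.
Proof. by rewrite le_max lexx orbT. Qed.

Definition risk_rule (r : rule R (T * E)) (mr : measurable_rule r)
    (rho : risk_measure R Omega) (gamma : R) : rule R T :=
  fun tau => NngNum (max0r_ge0 (rho (outcome_mfun mr tau) - gamma)).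

(* Labelled by the original rules: distinct rules may induce the same function
   on [T]. *)
Definition risk_rulebook (B : rulebook R (T * E))
    (mB : forall r : rules B, measurable_rule (val r))
    (rho : rules B -> risk_measure R Omega) (gamma : rules B -> R) :
    indexed_rulebook R (rules B) T :=
  @IndexedRulebook R (rules B) T
    (fun r => risk_rule (mB r) (rho r) (gamma r))
    (finite_setT_rules B) (prio B) (@prio_refl _ _ B) (@prio_trans _ _ B).

End risk_aware.

(* Main.v *)
(* If all three alternatives fail, then [tau'] strictly improves on the optimal
   trajectory: every rule that is not below [r'] has almost surely no larger
   outcome, hence no larger risk, and [r'] itself has strictly smaller risk.
   Any rule on which [tau'] is worse is therefore below [r'] and is compensated
   by [r'], while no rule above [r'] can compensate the loss on [r']. *)

Require Import Defs.
From mathcomp Require Import all_boot all_order all_algebra.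
From mathcomp Require Import all_classical all_reals all_analysis.

Set Implicit Arguments.
Unset Strict Implicit.
Unset Printing Implicit Defensive.

Import Order.TTheory GRing.Theory Num.Theory.

Local Open Scope classical_set_scope.
Local Open Scope ring_scope.

(** The set where [g w < f w] is measurable, so it can itself serve as the exceptional null set. The
    negated positivity is the form in which the failure of the third alternative arrives. *)
Lemma ae_le_of_gt_null d (T : measurableType d) (R : realType)
  (mu : {measure set T -> \bar R}) (f g : {mfun T >-> R}) :
  ~ (0 < mu [set w | (g w < f w)%R])%E -> {ae mu, forall w, f w <= g w}.
Proof.
move=> /negP; rewrite lt0e measure_ge0 andbT negbK => /eqP mu0.
exists [set w | g w < f w]; split => //.
  have mgf : measurable_fun [set: T] (fun w => g w < f w).
    exact: measurable_realfun.measurable_fun_ltr.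
  rewrite -[X in measurable X]setTI.
  exact: (mgf measurableT [set true]).
by move=> w /= /negP; rewrite -ltNge.
Qed.

Theorem proposition4 (R : realType) (dT dE dO : measure_display)
  (T : measurableType dT) (E : measurableType dE) (Omega : measurableType dO)
  (sT : standard_borel R T) (sE : standard_borel R E)
  (sO : standard_borel R Omega) (Omega0 : [set: Omega] !=set0)
  (P : probability Omega R) (env : {mfun (T * Omega)%type >-> E})
  (B : rulebook R (T * E)%type)
  (mB : forall r : rules B, measurable_rule (val r))
  (rho : rules B -> risk_measure R Omega) (gamma : rules B -> R)
  (tau_opt : T)
  (tau_optP : optimal (risk_rulebook env mB rho gamma) tau_opt)
  (rho_mono : forall r : rules B, monotone_risk P (rho r))
  (rho_smono : forall r : rules B, strictly_monotone_risk P (rho r))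
  (tau' : T) (r' : rules B) (omega : Omega)
  (better : outcome env (val r') tau' omega
            < outcome env (val r') tau_opt omega) :
  [\/ P [set w | outcome env (val r') tau' w
                 < outcome env (val r') tau_opt w] = 0%E,
      rho r' (outcome_mfun env (mB r') tau_opt) <= gamma r'
    | exists2 r_opt : rules B, ~~ strict (prio B) r_opt r' &
        (0 < P [set w | (outcome env (val r_opt) tau' w
                         > outcome env (val r_opt) tau_opt w)%R])%E].
Proof.
have [P0|P0] := eqVneq (P [set w | outcome env (val r') tau' w
                                   < outcome env (val r') tau_opt w]) 0%E.
  exact: Or31.
have [le_gamma|gamma_lt] :=
    leP (rho r' (outcome_mfun env (mB r') tau_opt)) (gamma r').
  exact: Or32.
apply: Or33; apply: contrapT => no_worse; case: tau_optP.
have ae_le r : ~~ strict (prio B) r r' ->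
    {ae P, forall w, outcome_mfun env (mB r) tau' w
                     <= outcome_mfun env (mB r) tau_opt w}.
  by move=> rr'; apply: ae_le_of_gt_null => Pgt; apply: no_worse; exists r.
pose risk r tau := (risk_rule env (mB r) (rho r) (gamma r) tau)%:num.
have risk_le r : ~~ strict (prio B) r r' -> risk r tau' <= risk r tau_opt.
  (* Truncation at zero preserves weak inequalities. *)
  by move=> /ae_le /rho_mono le_rho; rewrite ge_max !le_max lexx lerB ?orbT.
have risk_lt : risk r' tau' < risk r' tau_opt.
  have rr' : ~~ strict (prio B) r' r' by rewrite /strict andbN.
  have lt_rho : rho r' (outcome_mfun env (mB r') tau')
      < rho r' (outcome_mfun env (mB r') tau_opt).
    by apply: rho_smono; [exact: ae_le | rewrite lt0e P0 measure_ge0].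
  (* Strictness survives the truncation because the risk of [tau_opt] exceeds [gamma r']: the larger
     side stays positive. *)
  by rewrite gt_max !lt_max ltrD2r lt_rho subr_gt0 gamma_lt.
exists tau'; split => [r r_gt | /(_ r' risk_lt)[r /andP[_ r'r] r_gt]].
  (* By contraposition of [risk_le], a rule on which [tau'] is worse lies strictly below [r']. *)
  exists r' => //; apply: contraLR r_gt => /risk_le; by rewrite -leNgt.
(* A compensating [r] strictly above [r'] cannot be strictly below it, so [risk_le] applies to [r]
   and contradicts [r_gt]. *)
have := risk_le r; rewrite /strict negb_and r'r => /(_ isT).
by rewrite leNgt => /negP; apply.
Qed.
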